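(* If $G$ is a strongly regular graph with parameters $(99,14,1,2)$, then $G$ does not follow the Paley(9) pattern.
   Context: All graphs are finite, simple and connected. A graph $G=(V,E)$ is strongly regular with parameters $(n,k,\lambda,\mu)$ if it has $n$ vertices, is $k$-regular, is neither complete nor empty, every two adjacent vertices have exactly $\lambda$ common neighbours, and every two distinct non-adjacent vertices have exactly $\mu$ common neighbours. $N(v)$ denotes the set of neighbours of $v$, and $E(N(v))$ the set of edges of $G$ with both endpoints in $N(v)$. The Paley(9) graph is the graph with vertex set the field $GF(9)$ in which two distinct vertices are adjacent iff their difference is a non-zero square in $GF(9)$; it is strongly regular with parameters $(9,4,1,2)$. Let $G$ be strongly regular with parameters $(n,k,1,2)$. For a vertex $v$, the condition $\lambda=1$ implies that $E(N(v))$ is a perfect matching of $N(v)$. For two non-adjacent vertices $a,b\in N(v)$, let $(a,b)_v$ denote the unique common neighbour of $a$ and $b$ other than $v$ (it is a non-neighbour of $v$). The graph $G$ follows the Paley(9) pattern if for every vertex $v\in V$ and every two distinct edges $\{v_1,v_2\},\{v_3,v_4\}\in E(N(v))$, the subgraph of $G$ induced by $$P_v=\{v,v_1,v_2,v_3,v_4,(v_1,v_3)_v,(v_1,v_4)_v,(v_2,v_3)_v,(v_2,v_4)_v\}$$ is (isomorphic to) the Paley(9) graph. *)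

(* Defs.v *)
(* A graph is an adjacency relation [e : rel T] on a finite type [T] of vertices. *)
From mathcomp Require Import all_boot all_order all_algebra all_fingroup all_field.

Set Implicit Arguments.
Unset Strict Implicit.
Unset Printing Implicit Defensive.

Import GRing.Theory.
Local Open Scope nat_scope.

Definition simple_graph (T : finType) (e : rel T) : Prop :=
  irreflexive e /\ symmetric e.

Definition connected_graph (T : finType) (e : rel T) : Prop :=
  forall x y : T, connect e x y.

Definition nbhd (T : finType) (e : rel T) (x : T) : {set T} := [set y | e x y].

Definition strongly_regular (T : finType) (e : rel T) (n k l m : nat) : Prop :=
  [/\ #|T| = n,
      forall x, #|nbhd e x| = k,
      (exists x y : T, x != y /\ ~~ e x y) /\ (exists x y : T, e x y),
      forall x y, e x y -> #|nbhd e x :&: nbhd e y| = l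
    & forall x y, x != y -> ~~ e x y -> #|nbhd e x :&: nbhd e y| = m].

Definition edges_in (T : finType) (e : rel T) (A : {set T}) : {set {set T}} :=
  [set [set x; y] | x in A, y in A & e x y].

Definition induced (T : finType) (e : rel T) (A : {set T}) :
  rel {x : T | x \in A} := fun x y => e (val x) (val y).

Definition graph_isomorphic (T U : finType) (e : rel T) (f : rel U) : Prop :=
  exists2 h : T -> U, bijective h & forall x y, f (h x) (h y) = e x y.

(* The library proves the existence of finite fields of prime power order by an
   opaque lemma; [card_GF9] and [pchar_GF9] characterize the field it yields. *)
Definition GF9 : finFieldType := s2val (@pPrimePowerField 3 2 isT isT).

Lemma card_GF9 : #|GF9| = 9.
Proof. exact: s2valP' (@pPrimePowerField 3 2 isT isT). Qed.

Lemma pchar_GF9 : 3 \in [pchar GF9]%R.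
Proof. exact: s2valP (@pPrimePowerField 3 2 isT isT). Qed.

Definition paley9 : rel GF9 := fun x y =>
  (x != y) && [exists z : GF9, (z != 0%R) && (x - y == z ^+ 2)%R].

(* The vertex (a, b)_v.  The default value [v] is irrelevant: when [mu = 2] and
   [a], [b] are distinct non-adjacent neighbours of [v], the vertex exists and
   is unique, see [other_common_nbP]. *)
Definition other_common_nb (T : finType) (e : rel T) (v a b : T) : T :=
  odflt v [pick w in (nbhd e a :&: nbhd e b) :\ v].

Lemma other_common_nbP (T : finType) (e : rel T) (n k l : nat) (v a b : T) :
    simple_graph e -> strongly_regular e n k l 2 ->
    a \in nbhd e v -> b \in nbhd e v -> a != b -> ~~ e a b ->
  (nbhd e a :&: nbhd e b) :\ v = [set other_common_nb e v a b].
Proof.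
move=> [_ eC] [_ _ _ _ mu2] va vb ab nab.
have: #|(nbhd e a :&: nbhd e b) :\ v| == 1.
  have := cardsD1 v (nbhd e a :&: nbhd e b).
  rewrite mu2 // !inE !(eC _ v); move: va vb; rewrite !inE => -> -> /eqP.
  by rewrite add1n eqSS eq_sym.
case/cards1P=> w Dw; rewrite /other_common_nb.
case: pickP => [x | /(_ w)]; first by rewrite Dw inE => /eqP->.
by rewrite Dw set11.
Qed.

Definition pattern_set (T : finType) (e : rel T) (v v1 v2 v3 v4 : T) : {set T} :=
  [set v; v1; v2; v3; v4;
     other_common_nb e v v1 v3; other_common_nb e v v1 v4;
     other_common_nb e v v2 v3; other_common_nb e v v2 v4].

Definition follows_paley9_pattern (T : finType) (e : rel T) : Prop :=
  forall v v1 v2 v3 v4 : T,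
    [set v1; v2] \in edges_in e (nbhd e v) ->
    [set v3; v4] \in edges_in e (nbhd e v) ->
    [set v1; v2] != [set v3; v4] ->
  graph_isomorphic (induced e (A:=pattern_set e v v1 v2 v3 v4)) paley9.

(* Main.v *)
(* Lines are the triangles of the graph.  The pattern says that a line and an edge
   leaving it span a 3 x 3 grid of vertices, whose rows are parallel to one another.
   As 99 = 9 + 9 * 10, every vertex outside a grid has exactly one neighbour in it.
   It follows that the lines that are equal to, parallel to, or without any edge to
   a given line A partition the vertices, and that this family is closed under
   parallelism.  For two intersecting lines A and B, the resulting equivalence
   relations commute, the squares being closed up inside grids, and meet trivially.
   Composing the relations of three lines through a vertex gives an equivalence
   relation all of whose classes have 3 * 3 * 3 = 27 elements, but 27 does not
   divide 99. *)
Require Import Defs.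
From mathcomp Require Import all_boot all_order all_algebra all_fingroup all_field.

Set Implicit Arguments.
Unset Strict Implicit.
Unset Printing Implicit Defensive.

(** * Commuting equivalence relations with classes of constant size *)

Section CommutingEquivalences.

Variable T : finType.
Implicit Types (R S : rel T) (x y z : T).

Definition uniform_equiv R (d : nat) : Prop :=
  [/\ reflexive R, symmetric R, transitive R & forall x, #|[set y | R x y]| = d].

(** One inclusion between the two composites; for symmetric relations the other follows by
    reversal. *)
Definition commuting R S : Prop :=
  forall x y z, R x y -> S y z -> exists2 y', S x y' & R y' z.

Definition transverse R S : Prop := forall x y, R x y -> S x y -> x = y.

Definition rel_comp R S : rel T := fun x z => [exists y, R x y && S y z].

Lemma rel_compP R S x z :
  reflect (exists2 y, R x y & S y z) (rel_comp R S x z).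
Proof.
by apply: (iffP existsP) => [[y /andP[Rxy Syz]]|[y Rxy Syz]]; exists y => //; rewrite Rxy.
Qed.

Lemma uniform_equiv_dvd R d : uniform_equiv R d -> d %| #|T|.
Proof.
case=> Rr Rs Rt Rd.
have eqR : {in [set: T] & &, equivalence_rel R}.
  move=> x y z _ _ _; split=> // Rxy; apply/idP/idP; last exact: Rt.
  by apply: Rt; rewrite Rs.
have PT := equivalence_partitionP eqR.
have := @card_uniform_partition _ d (equivalence_partition R setT) [set: T].
rewrite cardsT => -> //; first exact: dvdn_mull.
move=> B /imsetP[x _ ->]; rewrite -(Rd x); apply: eq_card => y.
by rewrite !inE.
Qed.

(** Commutation yields symmetry and transitivity. A class of the composite is the union of the
    [S]-classes of the [m] elements of an [R]-class, and transversality makes these disjoint. *)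
Lemma uniform_equiv_comp R S m n :
    uniform_equiv R m -> uniform_equiv S n -> commuting R S -> transverse R S ->
  uniform_equiv (rel_comp R S) (m * n).
Proof.
move=> [Rr Rs Rt Rm] [Sr Ss St Sn] RS RS1; split.
- by move=> x; apply/rel_compP; exists x.
- suff sub x z : rel_comp R S x z -> rel_comp R S z x.
    by move=> x z; apply/idP/idP; apply: sub.
  case/rel_compP=> y Rxy Syz; have [y' Sxy' Ry'z] := RS _ _ _ Rxy Syz.
  by apply/rel_compP; exists y'; rewrite 1?Rs 1?Ss.
- move=> y x z /rel_compP[a Rxa Say] /rel_compP[b Ryb Sbz].
  have [||c Sbc Rca] := RS b y a; rewrite 1?Rs 1?Ss //.
  apply/rel_compP; exists c; first by apply: Rt Rxa _; rewrite Rs.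
  by apply: St Sbz; rewrite Ss.
(* [F y] is empty off the [R]-class of [x], so that the union can be indexed by all of [T]. *)
move=> x; pose F y := [set z | R x y && S y z].
have dF y y' : y != y' -> [disjoint F y & F y'].
  apply: contraNT => /pred0Pn[z /=].
  rewrite !inE => /andP[/andP[Rxy Syz] /andP[Rxy' Sy'z]]; apply/eqP/RS1.
    by apply: Rt Rxy'; rewrite Rs.
  by apply: St Syz _; rewrite Ss.
have -> : [set z | rel_comp R S x z] = \bigcup_y F y.
  apply/setP=> z; rewrite inE; apply/rel_compP/bigcupP=> -[y].
    by move=> Rxy Syz; exists y; rewrite ?inE ?Rxy.
  by rewrite !inE => _ /andP[]; exists y.
rewrite -sum1_card partition_disjoint_bigcup // -(Rm x) -sum_nat_const.
rewrite [RHS]big_mkcond /=; apply: eq_bigr => y _; rewrite sum1_card inE.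
case: ifP => Rxy; last by apply: eq_card0 => z; rewrite !inE Rxy.
by rewrite -(Sn y); apply: eq_card => z; rewrite !inE Rxy.
Qed.

End CommutingEquivalences.

(** * Lines and grids *)

Section Lines.

Variables (T : finType) (e : rel T).
Implicit Types (x y z w : T) (A B L M X Y : {set T}).

Definition is_line L : bool :=
  (#|L| == 3) && [forall x in L, forall y in L, (x != y) ==> e x y].

Definition parallel L M : bool :=
  [&& [disjoint L & M], [forall x in L, exists y in M, e x y]
    & [forall y in M, exists x in L, e x y]].

(** The rows are [A], [X], [Y]; the last clause makes the columns triangles as well. *)
Definition grid A X Y : Prop :=
  [/\ is_line A, is_line X, is_line Y,
      [/\ parallel A X, parallel A Y & parallel X Y]
    & forall x y z, x \in A -> y \in X -> z \in Y -> e x y -> e x z -> e y z].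

Definition grid_extension : Prop :=
  forall A v b, is_line A -> v \in A -> b \notin A -> e v b ->
  exists X Y, b \in X /\ grid A X Y.

Lemma line_adj L x y : is_line L -> x \in L -> y \in L -> x != y -> e x y.
Proof.
case/andP=> _ /forall_inP/(_ x) LP xL yL xy.
by move/(_ xL)/forall_inP/(_ y yL)/implyP: LP; apply.
Qed.

(** * Lines and squares when $\lambda=1$ and $\mu=2$ *)

Hypotheses (eI : irreflexive e) (eC : symmetric e).
Hypothesis lam1 : forall x y, e x y -> #|nbhd e x :&: nbhd e y| = 1.
Hypothesis mu2 :
  forall x y, x != y -> ~~ e x y -> #|nbhd e x :&: nbhd e y| = 2.

Lemma adj_neq x y : e x y -> x != y.
Proof. by apply: contraTneq => ->; rewrite eI. Qed.

Lemma triangle_uniq x y z w : e x y -> e x z -> e y z -> e x w -> e y w -> z = w.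
Proof.
move=> /lam1/eqP/cards1P[u Du] xz yz xw yw.
have /set1P-> : z \in [set u] by rewrite -Du !inE xz.
by apply/esym/set1P; rewrite -Du !inE xw.
Qed.

Lemma square_uniq x y z z' w : x != y -> ~~ e x y -> z != z' ->
  e z x -> e z y -> e z' x -> e z' y -> e w x -> e w y -> (w == z) || (w == z').
Proof.
move=> xy /(mu2 xy) c2 zz' zx zy z'x z'y wx wy.
have : [set z; z'] == nbhd e x :&: nbhd e y.
  rewrite eqEcard c2 cards2 zz' andbT.
  apply/subsetP=> u /set2P[]->; rewrite !inE !(eC x) !(eC y).
    by rewrite zx zy.
  by rewrite z'x z'y.
by move/eqP/setP/(_ w); rewrite !inE !(eC x) !(eC y) wx wy.
Qed.

Lemma line_third L x y : is_line L -> x \in L -> y \in L -> x != y ->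
  exists2 z, [/\ z \in L, z != x & z != y] & L = [set x; y; z].
Proof.
move=> /andP[/eqP L3 _] xL yL xy.
have : #|L :\ x :\ y| == 1.
  by move: L3; rewrite (cardsD1 x) xL (cardsD1 y (L :\ x)) !inE (eq_sym y) xy yL !add1n => -[->].
case/cards1P=> z Dz; exists z.
  have: z \in L :\ x :\ y by rewrite Dz set11.
  by rewrite !inE => /and3P[].
by rewrite -setUA -Dz !setD1K // !inE (eq_sym y) xy.
Qed.

Lemma line_closed L x y w :
  is_line L -> x \in L -> y \in L -> x != y -> e w x -> e w y -> w \in L.
Proof.
move=> lL xL yL xy wx wy; have [z [zL zx zy] _] := line_third lL xL yL xy.
rewrite -(@triangle_uniq x y z w) //; rewrite 1?[e _ w]eC // (line_adj lL) //.
  by rewrite eq_sym.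
by rewrite eq_sym.
Qed.

Lemma line_nbr_uniq L x y w :
  is_line L -> w \notin L -> x \in L -> y \in L -> e w x -> e w y -> x = y.
Proof.
move=> lL wL xL yL wx wy; apply: contraNeq wL => xy.
exact: line_closed lL xL yL xy wx wy.
Qed.

Lemma line_eq L M x y : is_line L -> is_line M ->
  x \in L -> y \in L -> x \in M -> y \in M -> x != y -> L = M.
Proof.
move=> lL lM xL yL xM yM xy; have [z [zL zx zy] DL] := line_third lL xL yL xy.
apply/eqP; rewrite eqEcard; case/andP: (lL) (lM) => /eqP-> _ /andP[/eqP-> _].
rewrite andbT; apply/subsetP=> u; rewrite DL !inE -orbA => /or3P[]/eqP-> //.
by apply: line_closed lM xM yM xy _ _; apply: line_adj lL _ _ _.
Qed.

Lemma line_set3 x y z : e x y -> e x z -> e y z -> is_line [set x; y; z].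
Proof.
move=> xy xz yz; apply/andP; split.
  rewrite -setUA cardsU1 cards2 !inE negb_or.
  by rewrite (adj_neq xy) (adj_neq xz) (adj_neq yz).
apply/forall_inP=> u; rewrite !inE -orbA => /or3P[]/eqP->;
  apply/forall_inP=> v; rewrite !inE -orbA => /or3P[]/eqP->;
  by rewrite ?eqxx //= ?[e y x]eC ?[e z _]eC ?xy ?xz ?yz ?implybT.
Qed.

Lemma line_through x y : e x y -> exists2 L, is_line L & (x \in L) && (y \in L).
Proof.
move=> xy; have /eqP/cards1P[z Dz] := lam1 xy.
have: z \in nbhd e x :&: nbhd e y by rewrite Dz set11.
rewrite !inE => /andP[xz yz]; exists [set x; y; z]; first exact: line_set3.
by rewrite !inE !eqxx orbT.
Qed.

Lemma line_other L x : is_line L -> exists2 y, y \in L & y != x.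
Proof.
case/andP=> /eqP L3 _; have : 0 < #|L :\ x|.
  by have := cardsD1 x L; rewrite L3; case: (x \in L); case: #|_|.
by case/card_gt0P=> y; rewrite !inE => /andP[]; exists y.
Qed.

(** * Parallelism of lines *)

Lemma parallel_sym L M : parallel L M = parallel M L.
Proof.
suff sub L' M' : parallel L' M' -> parallel M' L' by apply/idP/idP; apply: sub.
case/and3P=> dLM /forall_inP LM /forall_inP ML; apply/and3P; split.
- by rewrite disjoint_sym.
- by apply/forall_inP=> x /ML /exists_inP[y yL xy]; apply/exists_inP; exists y; rewrite 1?eC.
- by apply/forall_inP=> x /LM /exists_inP[y yL xy]; apply/exists_inP; exists y; rewrite 1?eC.
Qed.

Lemma parallelNin L M x : parallel L M -> x \in L -> x \notin M.
Proof. by case/and3P=> /disjointFr d _ _ /d->. Qed.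

Lemma parallel_nbr L M x : parallel L M -> x \in L -> exists2 y, y \in M & e x y.
Proof. by case/and3P=> _ /forall_inP LM _ /LM/exists_inP. Qed.

(** Let [l] be the neighbour of [m] in [L] and [k] another vertex of [L]. Both [M] and [M'] contain
    a common neighbour of [m] and [k] other than [l]; by $\mu=2$ it is the same vertex, so the two
    lines share an edge. *)
Lemma parallel_uniq L M M' m : is_line L -> is_line M -> is_line M' ->
  parallel M L -> parallel M' L -> m \in M -> m \in M' -> M = M'.
Proof.
move=> lL lM lM' ML M'L mM mM'.
have [l lL' ml] := parallel_nbr ML mM.
have [k kL kl] := line_other l lL.
have k_nbr N : is_line N -> parallel N L -> m \in N ->
    exists n, [/\ n \in N, e m n & e k n].
  move=> lN NL mN; have LN : parallel L N by rewrite parallel_sym.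
  have [n nN kn] := parallel_nbr LN kL; exists n; split=> //.
  apply: line_adj lN _ _ _ => //; apply: contraNneq kl => Dm.
  apply/eqP/(line_nbr_uniq lL (parallelNin NL mN)) => //.
  by rewrite Dm eC.
have [n [nM mn kn]] := k_nbr M lM ML mM.
have [n' [nM' mn' kn']] := k_nbr M' lM' M'L mM'.
apply: (line_eq lM lM' mM nM mM' _ (adj_neq mn)).
have mkN : ~~ e m k.
  by apply: contraNN kl => mk; apply/eqP/(line_nbr_uniq lL (parallelNin ML mM)).
have mk : m != k by apply: contraTneq kL => <-; exact: parallelNin ML mM.
have nl : n != l by apply: contraTneq lL' => <-; exact: parallelNin ML nM.
have n'l : n' != l by apply: contraTneq lL' => <-; exact: parallelNin M'L nM'.
have := @square_uniq m k n l n' mk mkN nl.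
rewrite ![e n _]eC ![e l _]eC ![e n' _]eC ml mn kn mn' kn' (negbTE n'l) orbF.
rewrite (line_adj lL kL lL' kl).
by move/(_ isT isT isT isT isT isT)/eqP <-.
Qed.

(** The neighbour of [y] in [A] and the neighbour of [x] in [X] are already two common neighbours of
    [x] and [y], and $\mu=2$. *)
Lemma parallel_square A X x y w : is_line A -> is_line X -> parallel A X ->
  x \in A -> y \in X -> ~~ e x y -> e w x -> e w y -> w \in A :|: X.
Proof.
move=> lA lX AX xA yX xyN wx wy; rewrite inE.
have XA : parallel X A by rewrite parallel_sym.
have [y1 y1X xy1] := parallel_nbr AX xA; have [x1 x1A yx1] := parallel_nbr XA yX.
have xx1 : x != x1 by apply: contraNneq xyN => ->; rewrite eC.
have yy1 : y != y1 by apply: contraNneq xyN => ->.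
have xy : x != y by apply: contraTneq yX => <-; exact: parallelNin AX xA.
have zz : x1 != y1 by apply: contraTneq y1X => <-; exact: parallelNin AX x1A.
have := square_uniq xy xyN zz _ _ _ _ wx wy.
rewrite [e x1 x]eC [e y1 y]eC (line_adj lA xA x1A xx1) (line_adj lX yX y1X yy1).
rewrite [e x1 y]eC [e y1 x]eC yx1 xy1 => /(_ isT isT isT isT)/orP[]/eqP->.
  by rewrite x1A.
by rewrite y1X orbT.
Qed.

(** * Symmetry and closure of grids *)

Lemma grid_swap A X Y : grid A X Y -> grid A Y X.
Proof.
case=> lA lX lY [AX AY XY] t; split=> //; first by rewrite (parallel_sym Y).
by move=> x y z xA yY zX xy xz; rewrite eC (t x).
Qed.

Lemma grid_rot A X Y : grid A X Y -> grid X Y A.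
Proof.
case=> lA lX lY [AX AY XY] t; split=> //; first by rewrite !(parallel_sym _ A).
move=> y z x yX zY xA yz yx; have [z' z'Y xz'] := parallel_nbr AY xA.
have yz' : e y z' by apply: (t x) => //; rewrite eC.
by rewrite (line_nbr_uniq lY (parallelNin XY yX) zY z'Y yz yz') eC.
Qed.

Lemma grid_setU_rot A X Y : X :|: Y :|: A = A :|: X :|: Y.
Proof. by rewrite setUC setUA. Qed.

(** Reduction to a vertex of the first row. [P] sees the grid only through the union of its rows,
    which rotation preserves. *)
Lemma grid_ind (P : T -> {set T} -> Prop) :
    (forall A X Y, grid A X Y -> forall x, x \in A -> P x (A :|: X :|: Y)) ->
  forall A X Y, grid A X Y -> forall x, x \in A :|: X :|: Y -> P x (A :|: X :|: Y).
Proof.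
move=> PA A X Y gA x; rewrite !inE -orbA => /or3P[]xin; first exact: PA.
  by rewrite -grid_setU_rot; apply: PA xin; exact: grid_rot.
by rewrite -2!grid_setU_rot; apply: PA xin; do 2!apply: grid_rot.
Qed.

(** Two vertices in one row, or adjacent in one column, have only the third vertex of that line as
    common neighbour; non-adjacent vertices in different rows fall under [parallel_square]. *)
Lemma grid_closed A X Y x y w : grid A X Y ->
    x \in A :|: X :|: Y -> y \in A :|: X :|: Y -> x != y -> e w x -> e w y ->
  w \in A :|: X :|: Y.
Proof.
move=> gA xG; pose P x (G : {set T}) := y \in G -> x != y -> e w x -> e w y -> w \in G.
suff PG : forall A X Y, grid A X Y -> forall x, x \in A -> P x (A :|: X :|: Y).
  by move: (grid_ind PG gA xG); apply.
rewrite {}/P => {A X Y x gA xG} A X Y gA x xA yG xy wx wy.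
have cross X' Y' : grid A X' Y' -> y \in X' -> w \in A :|: X' :|: Y'.
  case=> lA lX lY [AX AY XY] t yX; have [xyE|xyN] := boolP (e x y); last first.
    by rewrite inE (parallel_square lA lX AX xA yX xyN).
  have [z zY xz] := parallel_nbr AY xA.
  rewrite inE -(@triangle_uniq x y z w) ?zY ?orbT //; first exact: t xz.
    by rewrite eC.
  by rewrite eC.
move: yG; rewrite inE [in X in X || _]inE -orbA => /or3P[yA|yX|yY].
- by case: gA => lA _ _ _ _; rewrite !inE (line_closed lA xA yA).
- exact: cross.
by rewrite -setUA (setUC X) setUA; apply: cross => //; exact: grid_swap.
Qed.

(** At most two neighbours lie in the row of [x] and at most one in each other row. *)
Lemma grid_nbrs A X Y x : grid A X Y -> x \in A :|: X :|: Y ->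
  #|nbhd e x :&: (A :|: X :|: Y)| <= 4.
Proof.
move=> gA xG; pose P x (G : {set T}) : Prop := #|nbhd e x :&: G| <= 4.
suff PG : forall A X Y, grid A X Y -> forall x, x \in A -> P x (A :|: X :|: Y).
  by have := grid_ind PG gA xG.
rewrite {}/P => {A X Y x gA xG} A X Y gA x xA.
case: gA => lA lX lY [AX AY XY] _.
have le1 L : is_line L -> parallel A L -> #|nbhd e x :&: L| <= 1.
  move=> lL AL; apply/card_le1_eqP=> y z; rewrite !inE => /andP[xy yL] /andP[xz zL].
  by apply: (line_nbr_uniq lL (parallelNin AL xA)).
have A2 : #|nbhd e x :&: A| <= 2.
  have : nbhd e x :&: A \subset A :\ x.
    by apply/subsetP=> y; rewrite !inE eq_sym => /andP[/adj_neq->].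
  move/subset_leq_card/leq_trans; apply; case/andP: lA => /eqP.
  by rewrite (cardsD1 x) xA !add1n => -[->].
rewrite !setIUr (leq_trans (leq_card_setU _ _)) //.
rewrite -[4]/(2 + 1 + 1) leq_add ?le1 // (leq_trans (leq_card_setU _ _)) //.
by rewrite leq_add ?le1.
Qed.

Lemma grid_card A X Y : grid A X Y -> #|A :|: X :|: Y| = 9.
Proof.
case=> /andP[/eqP A3 _] /andP[/eqP X3 _] /andP[/eqP Y3 _] [AX AY XY] _.
have I0 L M : parallel L M -> L :&: M = set0 by case/and3P=> /disjoint_setI0.
by rewrite !cardsU setIUl (I0 _ _ AX) (I0 _ _ AY) (I0 _ _ XY) setU0 cards0 A3 X3 Y3.
Qed.

(** * Counting around a grid for $n=99$ and $k=14$ *)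

Hypotheses (n99 : #|T| = 99) (k14 : forall x, #|nbhd e x| = 14).

(* A vertex outside has at most one neighbour inside, and the 9 vertices inside
   send 9 * (14 - 4) = 99 - 9 edges outside. *)
Lemma grid_dominating A X Y w : grid A X Y -> w \notin A :|: X :|: Y ->
  exists2 x, x \in A :|: X :|: Y & e w x.
Proof.
move=> gA; pose G := A :|: X :|: Y => wG.
pose F x := if x \in G then nbhd e x :\: G else set0.
have dF x y : x != y -> [disjoint F x & F y].
  move=> xy; rewrite /F; case: ifP => xG; last by rewrite -setI_eq0 set0I.
  case: ifP => yG; last by rewrite -setI_eq0 setI0.
  apply/pred0P=> u /=; rewrite !inE; apply/negP=> /andP[/andP[uG xu] /andP[_ yu]].
  by case/negP: uG; rewrite -!in_setU; apply: (grid_closed gA xG yG xy); rewrite eC.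
have FG : \bigcup_x F x \subset ~: G.
  apply/bigcupsP=> x _; rewrite /F; case: ifP => _; last exact: sub0set.
  by apply/subsetP=> y; rewrite !inE => /andP[].
have leF : #|~: G| <= #|\bigcup_x F x|.
  rewrite -[leqRHS]sum1_card partition_disjoint_bigcup //.
  have := cardsC G; rewrite n99 (grid_card gA) => /(@addnI 9 _ 90) ->.
  have -> : 90 = #|G| * 10 by rewrite (grid_card gA).
  rewrite -sum_nat_const big_mkcond /=.
  apply: leq_sum => x _; rewrite sum1_card /F; case: ifP => // xG.
  rewrite cardsD k14 -[10]/(14 - 4); apply: leq_sub2l; exact: grid_nbrs.
have /eqP DG : \bigcup_x F x == ~: G by rewrite eqEcard FG.
have /bigcupP[x _] : w \in \bigcup_x F x by rewrite DG inE.
rewrite /F; case: ifP => xG; last by rewrite inE.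
by rewrite !inE => /andP[_ xw]; exists x; rewrite 1?eC.
Qed.

Hypothesis gridE : grid_extension.

Lemma transport A v b : is_line A -> v \in A -> b \notin A -> e v b ->
  exists X, [/\ is_line X, b \in X & parallel A X].
Proof.
move=> lA vA bA vb; have [X [Y [bX [_ lX _ [AX _ _] _]]]] := gridE lA vA bA vb.
by exists X.
Qed.

(** An edge from [A] to [X] spans a grid with [A]; its row through the end in [X] is parallel to
    [A], hence equal to [X] by [parallel_uniq]. *)
Lemma parallel_grid A X :
  is_line A -> is_line X -> parallel A X -> exists Y, grid A X Y.
Proof.
move=> lA lX AX; have /card_gt0P[v vA] : 0 < #|A| by case/andP: lA => /eqP->.
have [b bX vb] := parallel_nbr AX vA.
have bA : b \notin A by apply: (parallelNin _ bX); rewrite parallel_sym.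
have [X' [Y [bX' gA]]] := gridE lA vA bA vb; exists Y.
have [_ lX' _ [AX' _ _] _] := gA.
by rewrite (@parallel_uniq A X X' b) // parallel_sym.
Qed.

(** * Vertices and lines without contact to a given line *)

Definition far A w : bool := [forall a in A, (a != w) && ~~ e a w].

Definition remote A L : bool := [forall w in L, far A w].

Lemma remote_far A L w : remote A L -> w \in L -> far A w.
Proof. by move/forall_inP; apply. Qed.

Lemma farP A w : reflect (forall a, a \in A -> a != w /\ ~~ e a w) (far A w).
Proof. by apply: (iffP forall_inP) => H a /H/andP. Qed.

Lemma farNin A w : far A w -> w \notin A.
Proof. by move/farP=> wA; apply/negP=> /wA[/eqP]. Qed.

Lemma parallelNfar A L w : parallel A L -> w \in L -> ~~ far A w.
Proof.
rewrite parallel_sym => LA wL; have [a aA wa] := parallel_nbr LA wL.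
by apply/farP=> /(_ a aA)[_]; rewrite eC wa.
Qed.

Lemma remote_sym A L : remote A L = remote L A.
Proof.
suff sub A' L' : remote A' L' -> remote L' A' by apply/idP/idP; apply: sub.
move/forall_inP=> AL; apply/forall_inP=> a aA; apply/forall_inP=> w wL.
by have /farP/(_ a aA)[] := AL w wL; rewrite eq_sym eC => -> ->.
Qed.

Lemma remotePn A L :
  ~~ remote A L -> exists w a, [/\ w \in L, a \in A & (a == w) || e a w].
Proof.
case/forall_inPn=> w wL /forall_inPn[a aA]; rewrite negb_and !negbK.
by exists w, a.
Qed.

Lemma grid_near A X Y w : grid A X Y -> w \in A :|: X :|: Y -> ~~ far A w.
Proof.
case=> _ _ _ [AX AY _] _; rewrite !inE -orbA => /or3P[wA|wX|wY].
- by apply: contraL wA; exact: farNin.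
- exact: parallelNfar AX wX.
exact: parallelNfar AY wY.
Qed.

(** * Related lines: closure under parallelism, existence and uniqueness through a vertex *)

Definition related A L : bool := [|| A == L, parallel A L | remote A L].

Lemma related_refl A : related A A.
Proof. by rewrite /related eqxx. Qed.

Lemma related_sym A L : related A L = related L A.
Proof. by rewrite /related eq_sym parallel_sym remote_sym. Qed.

(** If [M] is not remote, some [m] in [M] lies in [A], which forces [M] to be [A], or has neighbours
    in both [A] and [L]. In the latter case [m] lies in the grid on [A] and [L], and [M] is its
    third row. *)
Lemma parallel_related A L M : is_line A -> is_line L -> is_line M ->
  parallel A L -> parallel L M -> related A M.
Proof.
move=> lA lL lM AL LM; have LA : parallel L A by rewrite parallel_sym.
have ML : parallel M L by rewrite parallel_sym.
have [rAM|] := boolP (remote A M); first by rewrite /related rAM !orbT.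
case/remotePn=> m [a [mM aA am]].
have [mA|mA] := boolP (m \in A).
  by rewrite (parallel_uniq lL lA lM AL ML mA mM) related_refl.
have{am} ma : e m a.
  by case/orP: am => [/eqP am|]; [rewrite -am aA in mA | rewrite eC].
have [l lL' ml] := parallel_nbr ML mM.
have [N gA] := parallel_grid lA lL AL; have [_ _ lN [_ AN LN] _] := gA.
have : m \in A :|: L :|: N.
  apply: (grid_closed gA _ _ _ ma ml); rewrite ?inE ?aA ?lL' ?orbT //.
  by apply: contraTneq lL' => <-; exact: parallelNin AL aA.
rewrite !inE (negbTE mA) (negbTE (parallelNin ML mM)) /= => mN.
have NL : parallel N L by rewrite parallel_sym.
by rewrite -(parallel_uniq lL lN lM NL ML mN mM) /related AN orbT.
Qed.

(** The grid spanned by [A] and the edge [a x] contains [x'], a neighbour of [a'] and [x], and then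
    [w], a neighbour of [x] and [x']. But no vertex of a grid is far from its row [A]. *)
Lemma far_line_touches_once A w x x' a a' : is_line A -> far A w ->
  a \in A -> a' \in A -> e w x -> e w x' -> e x x' -> e a x -> e a' x' -> False.
Proof.
move=> lA wA aA a'A wx wx' xx' ax a'x'.
have xA : x \notin A by apply: contraTN wx => /(farP _ _ wA)[_]; rewrite eC.
have [X [Y [xX gA]]] := gridE lA aA xA ax.
have x'G : x' \in A :|: X :|: Y.
  apply: (grid_closed gA (x := a') (y := x)); rewrite ?inE ?a'A ?xX ?orbT //.
  - by apply: contraNneq xA => <-.
  - by rewrite eC.
  by rewrite eC.
have wG : w \in A :|: X :|: Y.
  apply: (grid_closed gA _ x'G (adj_neq xx') wx wx').
  by rewrite !inE xX orbT.
by case/negP: (grid_near gA wG).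
Qed.

(* Two of the seven lines through [w] avoiding the neighbourhood of [A] would
   leave only five lines for the six neighbours of [w] adjacent to [A], which lie
   on distinct lines. *)
Lemma remote_uniq A L M w : is_line A -> is_line L -> is_line M ->
  remote A L -> remote A M -> w \in L -> w \in M -> L = M.
Proof.
move=> lA lL lM AL AM wL wM; apply/eqP/negPn/negP=> LM.
have wA := remote_far AL wL.
pose F a := if a \in A then nbhd e w :&: nbhd e a else set0.
pose S := \bigcup_a F a.
have inS x : x \in S -> e w x /\ exists2 a, a \in A & e a x.
  case/bigcupP=> a _; rewrite /F; case: ifP => [aA|]; last by rewrite inE.
  by rewrite !inE => /andP[wx ax]; split=> //; exists a.
have S6 : #|S| = 6.
  rewrite -sum1_card partition_disjoint_bigcup => [|a a' aa']; last first.
    rewrite /F; case: ifP => aA; last by rewrite -setI_eq0 set0I.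
    case: ifP => a'A; last by rewrite -setI_eq0 setI0.
    apply/pred0P=> x /=; apply/negbTE; rewrite !inE.
    apply/negP=> /andP[/andP[wx ax] /andP[_ a'x]].
    have xA : x \in A by apply: line_closed lA aA a'A aa' _ _; rewrite eC.
    by case: (farP _ _ wA x xA) => _; rewrite eC wx.
  have -> : 6 = #|A| * 2 by case/andP: lA => /eqP->.
  rewrite -sum_nat_const [RHS]big_mkcond; apply: eq_bigr => a _.
  rewrite sum1_card /F; case: ifP => aA; last by rewrite cards0.
  by have [aw aw'] := farP _ _ wA a aA; rewrite mu2 // 1?eq_sym // eC.
(* The third vertex of the line through [w] and [x]; for [x] adjacent to [w], $\lambda=1$ rules out
   the default value. *)
pose t x := odflt x [pick y in nbhd e w :&: nbhd e x].
have tP x : e w x -> e w (t x) /\ e x (t x).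
  move=> wx; rewrite /t; case: pickP => [y|]; first by rewrite !inE => /andP.
  by move/eq_card0; rewrite lam1.
have tK x : e w x -> t (t x) = x.
  move=> wx; have [wtx xtx] := tP x wx; have [wttx txttx] := tP _ wtx.
  by apply/esym/(@triangle_uniq w (t x)) => //; rewrite eC.
have tS6 : #|t @: S| = 6.
  rewrite card_in_imset // => x y /inS[wx _] /inS[wy _] txy.
  by rewrite -(tK x) // txy tK.
have dS : [disjoint S & t @: S].
  apply/pred0P=> y /=; apply/negP=> /andP[yS /imsetP[x xS Dy]].
  have [wx [a aA ax]] := inS x xS; have [wy [b bA bY]] := inS y yS.
  apply: (far_line_touches_once lA wA aA bA wx wy) => //.
  by rewrite Dy; case: (tP x wx).
have dLS N : is_line N -> remote A N -> w \in N -> [disjoint N :\ w & S :|: t @: S].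
  move=> lN AN wN; apply/pred0P=> y /=; apply/negP.
  rewrite !inE => /andP[/andP[yw yN] /orP[/inS[_ [a aA ay]]|/imsetP[x xS Dy]]].
    by case: (farP _ _ (remote_far AN yN) a aA) => _; rewrite ay.
  have [wx [a aA ax]] := inS x xS; have [wy xy] := tP x wx.
  have xN : x \in N by apply: (line_closed lN wN yN); rewrite ?Dy // 1?eC // -Dy eq_sym.
  by case: (farP _ _ (remote_far AN xN) a aA) => _; rewrite ax.
have LM2 : #|L :\ w :|: M :\ w| = 4.
  have LM0 : (L :\ w) :&: (M :\ w) = set0.
    apply/eqP/set0Pn=> -[y]; rewrite !inE => /andP[/andP[yw yL] /andP[_ yM]].
    by case/eqP: LM; apply: line_eq lL lM wL yL wM yM _; rewrite eq_sym.
  rewrite cardsU LM0 cards0 subn0.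
  case/andP: (lL) (lM) => /eqP + _ /andP[/eqP + _].
  by rewrite (cardsD1 w L) (cardsD1 w M) wL wM !add1n => -[->] [->].
have : (L :\ w :|: M :\ w) :|: (S :|: t @: S) \subset nbhd e w.
  apply/subsetP=> y; rewrite 3!in_setU [y \in nbhd _ _]inE.
  case/orP=> [/orP[]|/orP[/inS[]//|/imsetP[x /inS[wx _]->]]].
  - by case/setD1P=> yw yL; apply: line_adj lL _ _ _; rewrite 1?eq_sym.
  - by case/setD1P=> yw yM; apply: line_adj lM _ _ _; rewrite 1?eq_sym.
  by case: (tP x wx).
(* The sets are disjoint, giving $4+6+6=16>14$ neighbours of [w]. *)
move/subset_leq_card; rewrite k14 cardsU LM2 cardsU S6 tS6 (disjoint_setI0 dS).
rewrite setIUl !(disjoint_setI0 (dLS _ _ _ _)) //.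
by rewrite setU0 cards0.
Qed.

(** By domination [w] has a neighbour in the grid, necessarily in [X] or [Y]. The parallel to that
    row through [w] is related to [A], and can only be remote because [w] is far from [A]. *)
Lemma far_grid_line A X Y w : grid A X Y -> far A w ->
  exists L, [/\ is_line L, w \in L, remote A L & parallel X L || parallel Y L].
Proof.
move=> gA wA; pose G := A :|: X :|: Y.
have wG : w \notin G by apply: contraL wA; exact: grid_near.
have [x xG wx] := grid_dominating gA wG.
have [lA lX lY [AX AY _] _] := gA.
have step Z : is_line Z -> parallel A Z -> x \in Z -> w \notin Z ->
    exists L, [/\ is_line L, w \in L, remote A L & parallel Z L].
  move=> lZ AZ xZ wZ; have xw : e x w by rewrite eC.
  have [L [lL wL ZL]] := transport lZ xZ wZ xw.
  exists L; split=> //; have := parallel_related lA lZ lL AZ ZL.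
  case/or3P=> // [/eqP DA|AL]; first by rewrite -DA (negbTE (farNin wA)) in wL.
  by have := parallelNfar AL wL; rewrite wA.
move: wG; rewrite !inE !negb_or => /andP[/andP[_ wX] wY].
move: xG; rewrite !inE -orbA => /or3P[xA|xX|xY].
- by case: (farP _ _ wA x xA) => _; rewrite eC wx.
- by have [L [? ? ? XL]] := step X lX AX xX wX; exists L; rewrite XL.
by have [L [? ? ? YL]] := step Y lY AY xY wY; exists L; rewrite YL orbT.
Qed.

(** [far_grid_line] gives such a remote line through a vertex of [L], and [remote_uniq] identifies
    it with [L]. *)
Lemma remote_grid A X Y L : grid A X Y -> is_line L -> remote A L ->
  parallel X L || parallel Y L.
Proof.
move=> gA lL AL; have /card_gt0P[w wL] : 0 < #|L| by case/andP: lL => /eqP->.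
have [M [lM wM AM XM]] := far_grid_line gA (remote_far AL wL).
have [lA _ _ _ _] := gA.
by rewrite (remote_uniq lA lL lM AL AM wL wM).
Qed.

(** The new case is [L] remote with some [m] in [M] adjacent to [A]. Take a grid on [A] with [m] in
    the row [X]. If [L] is parallel to [X], then [M] is [X]; if it is parallel to [Y], the neighbour
    [l] of [m] in [L] also has a neighbour in [Y] and falls into the grid, although it is far from
    [A]. *)
Lemma related_parallel A L M : is_line A -> is_line L -> is_line M ->
  related A L -> parallel L M -> related A M.
Proof.
move=> lA lL lM /or3P[/eqP<-|AL|AL] LM; first by rewrite /related LM orbT.
  exact: parallel_related AL LM.
have ML : parallel M L by rewrite parallel_sym.
have [rAM|] := boolP (remote A M); first by rewrite /related rAM !orbT.
case/remotePn=> m [a [mM aA am]].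
have [l lL' ml] := parallel_nbr ML mM; have lfA := remote_far AL lL'.
have mA : m \notin A by apply: contraTN ml => /(farP _ _ lfA)[].
have{} am : e a m by case/orP: am => // /eqP am; rewrite -am aA in mA.
have [X [Y [mX gA]]] := gridE lA aA mA am; have [_ lX lY [AX AY XY] _] := gA.
case/orP: (remote_grid gA lL AL) => [XL|].
  by rewrite -(parallel_uniq lL lX lM XL ML mX mM) /related AX orbT.
rewrite parallel_sym => LY; have [y yY ly] := parallel_nbr LY lL'.
suff lG : l \in A :|: X :|: Y by case/negP: (grid_near gA lG).
apply: (grid_closed gA (x := m) (y := y)); rewrite ?inE ?mX ?yY ?orbT //.
  by apply: contraTneq yY => <-; exact: parallelNin XY mX.
by rewrite eC.
Qed.

Lemma related_cover A w : is_line A ->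
  exists L, [/\ is_line L, w \in L & related A L].
Proof.
move=> lA; have [wA|wA] := boolP (w \in A).
  by exists A; rewrite related_refl.
have [wfA|] := boolP (far A w); last first.
  case/forall_inPn=> a aA; rewrite negb_and !negbK => /orP[/eqP aw|aw].
    by rewrite -aw aA in wA.
  have [X [lX wX AX]] := transport lA aA wA aw.
  by exists X; rewrite /related AX orbT.
have /card_gt0P[v vA] : 0 < #|A| by case/andP: lA => /eqP->.
(* As $14>3$, some neighbour of [v] lies outside [A] and spans a grid with [A]. *)
have /subsetPn[b] : ~~ (nbhd e v \subset A).
  by apply/negP=> /subset_leq_card; rewrite k14; case/andP: lA => /eqP->.
rewrite inE => vb bA; have [X [Y [_ gA]]] := gridE lA vA bA vb.
have [L [lL wL AL _]] := far_grid_line gA wfA.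
by exists L; rewrite /related AL !orbT.
Qed.

(** The position of [w] (in [A], adjacent to [A], or far from it) decides which of the three
    relations holds, and each has its own uniqueness. *)
Lemma related_uniq A L M w : is_line A -> is_line L -> is_line M ->
  related A L -> related A M -> w \in L -> w \in M -> L = M.
Proof.
move=> lA lL lM AL AM wL wM.
have relC N : related A N -> w \in N ->
    [\/ A = N /\ w \in A, [/\ parallel N A, w \notin A & ~~ far A w]
      | remote A N /\ far A w].
  case/or3P=> [/eqP<-|AN|AN] wN; first by constructor 1.
    constructor 2; rewrite (parallelNfar AN wN) parallel_sym AN; split=> //.
    by apply: (parallelNin _ wN); rewrite parallel_sym.
  by constructor 3; rewrite AN (remote_far AN wN).
have Nin := @farNin A w.
case: (relC L AL wL) => [[DL wA]|[LA /negP wA nwA]|[rL wA]];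
  case: (relC M AM wM) => [[DM wA']|[MA /negP wA' nwA']|[rM wA']] //.
- by rewrite -DL.
- by case/negP: (Nin wA').
- exact: parallel_uniq lA lL lM LA MA wL wM.
- by rewrite wA' in nwA.
- by case/negP: (Nin wA).
- by rewrite wA in nwA'.
exact: remote_uniq lA lL lM rL rM wL wM.
Qed.

(** * Spreads, that is, partitions of the vertices into lines, as equivalence relations *)

Definition spread_rel A : rel T := fun x y =>
  [exists L : {set T}, [&& is_line L, related A L, x \in L & y \in L]].

Lemma spread_relP A x y :
  reflect (exists L, [/\ is_line L, related A L, x \in L & y \in L])
          (spread_rel A x y).
Proof. by apply: (iffP existsP) => -[L /and4P]; exists L. Qed.

Lemma spread_rel_equiv A : is_line A -> uniform_equiv (spread_rel A) 3.
Proof.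
move=> lA; split.
- by move=> x; have [L [lL xL AL]] := related_cover x lA; apply/spread_relP; exists L.
- move=> x y.
  by apply/spread_relP/spread_relP=> -[L [lL AL xL yL]]; exists L.
- move=> y x z /spread_relP[L [lL AL xL yL]] /spread_relP[M [lM AM yM zM]].
  apply/spread_relP; exists L; split=> //.
  by rewrite (related_uniq lA lL lM AL AM yL yM).
move=> x; have [L [lL xL AL]] := related_cover x lA.
have <- : #|L| = 3 by case/andP: lL => /eqP.
apply: eq_card => y; rewrite inE; apply/spread_relP/idP=> [[M [lM AM xM yM]]|yL].
  by rewrite (related_uniq lA lL lM AL AM xL xM).
by exists L.
Qed.

(** Distinct [x] and [y] determine one line, related to both [A] and [B]. Seen from that line, [A]
    and [B] are related lines through [v], so they coincide. *)
Lemma spread_rel_transverse A B v : is_line A -> is_line B -> A != B ->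
  v \in A -> v \in B -> transverse (spread_rel A) (spread_rel B).
Proof.
move=> lA lB AB vA vB x y /spread_relP[L [lL AL xL yL]].
case/spread_relP=> M [lM BM xM yM]; apply: contraNeq AB => xy.
have DM := line_eq lL lM xL yL xM yM xy.
apply/eqP/(related_uniq lL lA lB _ _ vA vB); first by rewrite related_sym.
by rewrite DM related_sym.
Qed.

(** Move the line [x y] in parallel to [z], and the line [y z] to [x]. The neighbour of [x] on the
    first and that of [z] on the second are common neighbours of [x] and [z] other than [y]; by
    $\mu=2$ they agree and close the square. *)
Lemma spread_rel_commuting A B v : is_line A -> is_line B -> A != B ->
  v \in A -> v \in B -> commuting (spread_rel A) (spread_rel B).
Proof.
move=> lA lB AB vA vB x y z xAy yBz.
have trAB := spread_rel_transverse lA lB AB vA vB.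
have [Ar _ _ _] := spread_rel_equiv lA; have [Br _ _ _] := spread_rel_equiv lB.
have [Dxy|xy] := eqVneq x y; first by exists z; rewrite ?Dxy.
have [Dyz|yz] := eqVneq y z; first by exists x; rewrite -?Dyz.
case/spread_relP: (xAy) => L [lL AL xL yL].
case/spread_relP: (yBz) => M [lM BM yM zM].
have zL : z \notin L.
  apply: contra yz => zL; apply/eqP/trAB => //.
  by apply/spread_relP; exists L.
have xM : x \notin M.
  apply: contra xy => xM; apply/eqP/trAB => //.
  by apply/spread_relP; exists M.
have xyE := line_adj lL xL yL xy; have yzE := line_adj lM yM zM yz.
have yxE : e y x by rewrite eC.
have [L' [lL' zL' LL']] := transport lL yL zL yzE.
have [M' [lM' xM' MM']] := transport lM yM xM yxE.
have AL' := related_parallel lA lL lL' AL LL'.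
have BM' := related_parallel lB lM lM' BM MM'.
have [u uL' xu] := parallel_nbr LL' xL; have [u' u'M' zu'] := parallel_nbr MM' zM.
have xz : x != z by apply: contraTneq zL' => <-; exact: parallelNin LL' xL.
have xzN : ~~ e x z.
  by apply: contra yz => xzE; apply/eqP/(line_nbr_uniq lM xM yM zM xyE xzE).
have uz : u != z by apply: contraNneq xzN => <-.
have u'x : u' != x by apply: contraNneq xzN => <-; rewrite eC.
have yu : y != u by apply: contraTneq uL' => <-; exact: parallelNin LL' yL.
have yu' : y != u' by apply: contraTneq u'M' => <-; exact: parallelNin MM' yM.
have := @square_uniq x z y u u' xz xzN yu yxE yzE.
rewrite eC xu (line_adj lL' uL' zL' uz) (line_adj lM' u'M' xM' u'x) eC zu'.
rewrite eq_sym (negbTE yu') /= => /(_ isT isT isT isT)/eqP Du'.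
exists u; apply/spread_relP; first by exists M'; rewrite -Du'.
by exists L'.
Qed.

(** * The contradiction from three lines through a vertex *)

Lemma no_grid_extension : False.
Proof.
have /card_gt0P[v _] : 0 < #|T| by rewrite n99.
(* Applied to the union of the lines already chosen, which has at most 6 vertices. *)
have new_line (D : {set T}) : #|D| < 14 ->
    exists L b, [/\ is_line L, v \in L, b \in L & b \notin D].
  move=> D14; have /subsetPn[b] : ~~ (nbhd e v \subset D).
    by apply: contraL D14 => /subset_leq_card; rewrite k14 -leqNgt.
  rewrite inE => vb bD; have [L lL /andP[vL bL]] := line_through vb.
  by exists L, b.
have [|A [_ [lA vA _ _]]] := new_line set0; first by rewrite cards0.
have A3 : #|A| = 3 by case/andP: lA => /eqP.
have [|B [b [lB vB bB bA]]] := new_line A; first by rewrite A3.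
have B3 : #|B| = 3 by case/andP: lB => /eqP.
have [|C [c [lC vC cC]]] := new_line (A :|: B).
  by rewrite (leq_ltn_trans (leq_card_setU _ _)) // A3 B3.
rewrite inE negb_or => /andP[cA cB].
have AB : A != B by apply: contraNneq bA => ->.
have AC : A != C by apply: contraNneq cA => ->.
have BC : B != C by apply: contraNneq cB => ->.
have eA := spread_rel_equiv lA; have eB := spread_rel_equiv lB.
have eC3 := spread_rel_equiv lC.
have AB1 := spread_rel_transverse lA lB AB vA vB.
have AC1 := spread_rel_transverse lA lC AC vA vC.
have BC1 := spread_rel_transverse lB lC BC vB vC.
have cAB := spread_rel_commuting lA lB AB vA vB.
have cAC := spread_rel_commuting lA lC AC vA vC.
have cBC := spread_rel_commuting lB lC BC vB vC.
have eAB := uniform_equiv_comp eA eB cAB AB1.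
suff eABC : uniform_equiv
    (rel_comp (rel_comp (spread_rel A) (spread_rel B)) (spread_rel C)) (3 * 3 * 3).
  by have := uniform_equiv_dvd eABC; rewrite n99.
apply: uniform_equiv_comp => //.
- move=> x z w /rel_compP[y xAy yBz] zCw.
  have [y' yCy' y'Bw] := cBC _ _ _ yBz zCw.
  have [x' xCx' x'Ay'] := cAC _ _ _ xAy yCy'.
  by exists x' => //; apply/rel_compP; exists y'.
(* If [x], [y], [z] are distinct they form a triangle, so [y] is on the line joining [x] and [z];
   then [x] and [y] are related for both [A] and [C], against transversality. *)
move=> x z /rel_compP[y xAy yBz] xCz.
have [Dxy|xy] := eqVneq x y; first by apply: BC1; rewrite // Dxy.
have [Dyz|yz] := eqVneq y z; first by apply: AC1; rewrite // -Dyz.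
apply/eqP/negPn/negP=> xz; case/eqP: (xy); apply: AC1 => //.
case/spread_relP: xAy => L [lL AL xL yL]; case/spread_relP: yBz => M [lM BM yM zM].
case/spread_relP: xCz => N [lN CN xN zN]; apply/spread_relP; exists N; split=> //.
apply: (line_closed lN xN zN xz); first by rewrite eC (line_adj lL).
exact: line_adj lM yM zM yz.
Qed.

End Lines.

(** * From the Paley(9) pattern to grids *)

(** The third vertex is $-(x+y)$: in characteristic 3 the differences $x-y$, $y-z$ and $z-x$ are
    then all equal, hence the same square. *)
Lemma paley9_triangle (x y : GF9) :
  paley9 x y -> exists2 z, paley9 y z & paley9 z x.
Proof.
case/andP=> xy /existsP[c /andP[c0 /eqP Dc]].
have c3 : (1 + 1 + 1 = 0 :> GF9)%R.
  by rewrite -(GRing.pcharf0 pchar_GF9) !GRing.mulrS GRing.addr0 GRing.addrA.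
have paleyI (u w : GF9) : (u - w = x - y)%R -> paley9 u w.
  move=> uw; apply/andP; split; last by apply/existsP; exists c; rewrite c0 uw Dc /=.
  by rewrite -GRing.subr_eq0 uw GRing.subr_eq0.
have m2 (u : GF9) : (u + u = - u)%R.
  by apply/eqP; rewrite -GRing.addr_eq0 -[u]GRing.mul1r -!GRing.mulrDl c3 GRing.mul0r.
exists (- (x + y))%R; apply: paleyI.
  by rewrite GRing.opprK GRing.addrCA m2.
by rewrite GRing.opprD GRing.addrAC -GRing.opprD m2 GRing.opprK.
Qed.

(** The isomorphism carries over the triangles of Paley(9), so the third vertex of an edge of $P_v$
    stays in $P_v$. *)
Lemma pattern_triangle (T : finType) (e : rel T) (v a a' b b' x y : T) :
    follows_paley9_pattern e -> e v a -> e v a' -> e a a' ->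
    e v b -> e v b' -> e b b' -> b != a -> b != a' ->
    x \in pattern_set e v a a' b b' -> y \in pattern_set e v a a' b b' -> e x y ->
  exists z, [/\ z \in pattern_set e v a a' b b', e y z & e z x].
Proof.
move=> pat va va' aa' vb vb' bb' ba ba' xP yP xy.
have [||| h [g hK gK] hE] := pat v a a' b b'.
- by apply/imset2P; exists a a'; rewrite ?inE ?va ?va'.
- by apply/imset2P; exists b b'; rewrite ?inE ?vb ?vb'.
- by apply/eqP=> /setP/(_ b); rewrite !inE eqxx (negbTE ba) (negbTE ba').
have [|z] := @paley9_triangle (h (exist _ x xP)) (h (exist _ y yP)); first by rewrite hE.
rewrite -[z]gK !hE => yz zx; exists (val (g z)); split=> //; exact: valP.
Qed.

Section PatternGrids.

Variables (T : finType) (e : rel T) (n k : nat).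
Hypotheses (simple_e : simple_graph e) (srg_e : strongly_regular e n k 1 2).
Hypothesis pattern_e : follows_paley9_pattern e.

Let eI : irreflexive e. Proof. by case: simple_e. Qed.
Let eC : symmetric e. Proof. by case: simple_e. Qed.
Let lam1 x y : e x y -> #|nbhd e x :&: nbhd e y| = 1.
Proof. by case: srg_e => _ _ _ + _; apply. Qed.
Let mu2 x y : x != y -> ~~ e x y -> #|nbhd e x :&: nbhd e y| = 2.
Proof. by case: srg_e => _ _ _ _; apply. Qed.

Local Notation fourth := (other_common_nb e).

Lemma fourthC v a b : fourth v a b = fourth v b a.
Proof. by rewrite /other_common_nb setIC. Qed.

Lemma fourthP v a b : e v a -> e v b -> a != b -> ~~ e a b ->
  [/\ e a (fourth v a b), e b (fourth v a b), fourth v a b != v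
    & ~~ e v (fourth v a b)].
Proof.
move=> va vb ab nab.
have : fourth v a b \in (nbhd e a :&: nbhd e b) :\ v.
  by rewrite (other_common_nbP simple_e srg_e) ?inE.
rewrite !inE => /and3P[pv ap bp]; split=> //.
apply: contra ab => vp; apply/eqP; rewrite eC in bp; rewrite eC in ap.
by apply: (triangle_uniq lam1 vp); rewrite // eC.
Qed.

(** Two distinct lines [v a a'] and [v b b'] through [v]. The symmetries of this configuration carry
    facts about [fourth v a b] to the other three fourth vertices. *)
Definition crossing v a a' b b' : Prop :=
  [/\ [/\ e v a, e v a' & e a a'], [/\ e v b, e v b' & e b b']
    & [/\ b != a, b != a', b' != a & b' != a']].

Lemma crossing_sym v a a' b b' :
  crossing v a a' b b' -> crossing v b b' a a'.
Proof. by case=> A B [? ? ? ?]; split=> //; split; rewrite eq_sym. Qed.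

Lemma crossing_swap v a a' b b' : crossing v a a' b b' -> crossing v a' a b b'.
Proof. by case=> [[? ? ?]] B [? ? ? ?]; split=> //; split=> //; rewrite eC. Qed.

Lemma crossing_nadj v a a' b b' : crossing v a a' b b' -> ~~ e a b.
Proof.
case=> [[va va' aa'] [vb vb' bb'] [ba ba' _ _]]; apply: contra ba' => ab.
by apply/eqP; apply: (triangle_uniq lam1 va).
Qed.

Lemma crossing_fourth v a a' b b' : crossing v a a' b b' ->
  [/\ e a (fourth v a b), e b (fourth v a b), fourth v a b != v,
      ~~ e v (fourth v a b) & ~~ e a' (fourth v a b)].
Proof.
move=> cr; have nab := crossing_nadj cr.
have [[va va' aa'] [vb vb' bb'] [ba _ _ _]] := cr.
have [|ap bp pv nvp] := fourthP va vb _ nab; first by rewrite eq_sym.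
split=> //; apply: contra pv => a'p; apply/eqP.
by apply: (triangle_uniq lam1 aa'); rewrite // eC.
Qed.

(** The edge from [a] to [fourth v a b] has its third vertex in $P_v$. Each of the nine candidates
    except [fourth v a b'] is equal or non-adjacent to one end. *)
Lemma crossing_fourth_adj v a a' b b' :
  crossing v a a' b b' -> e (fourth v a b) (fourth v a b').
Proof.
move=> cr; have cr' := crossing_swap cr.
have crb := crossing_sym (crossing_swap (crossing_sym cr)).
have crb' := crossing_swap crb.
have [ap _ pv nvp na'p] := crossing_fourth cr.
have [_ _ _ _ nar] := crossing_fourth cr'.
have [_ _ _ _ nas] := crossing_fourth crb'.
have nab := crossing_nadj cr; have nab' := crossing_nadj crb.
have [[va va' aa'] [vb vb' bb'] [ba ba' _ _]] := cr.
have [||z] := pattern_triangle pattern_e va va' aa' vb vb' bb' ba ba' _ _ ap.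
- by rewrite !inE eqxx ?orbT.
- by rewrite !inE eqxx ?orbT.
have N x y : ~~ e x y -> e y x = false by rewrite eC => /negbTE.
rewrite !inE -!orbA => -[zP pz za]; move: zP pz za.
by do 8?[case/orP]; move/eqP->;
  rewrite ?eI ?(N _ _ nvp) ?(N _ _ na'p) ?(N _ _ nab) ?(N _ _ nab') ?(N _ _ nar) ?(N _ _ nas).
Qed.

Lemma crossing_grid v a a' b b' : crossing v a a' b b' ->
  grid e [set v; a; a'] [set b; fourth v a b; fourth v a' b]
         [set b'; fourth v a b'; fourth v a' b'].
Proof.
move=> cr; have cr' := crossing_swap cr.
have crb := crossing_sym (crossing_swap (crossing_sym cr)).
have crb' := crossing_swap crb.
have [ap bp pv nvp na'p] := crossing_fourth cr.
have [a'r br rv nvr nar] := crossing_fourth cr'.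
have [aq b'q qv nvq na'q] := crossing_fourth crb.
have [a's b's sv nvs nas] := crossing_fourth crb'.
have nab := crossing_nadj cr; have nab' := crossing_nadj crb.
have na'b := crossing_nadj cr'; have na'b' := crossing_nadj crb'.
have pq := crossing_fourth_adj cr; have rs := crossing_fourth_adj cr'.
have pr : e (fourth v a b) (fourth v a' b).
  by rewrite !(fourthC v _ b); exact: crossing_fourth_adj (crossing_sym cr).
have qs : e (fourth v a b') (fourth v a' b').
  by rewrite !(fourthC v _ b'); exact: crossing_fourth_adj (crossing_sym crb).
have [[va va' aa'] [vb vb' bb'] [ba ba' b'a b'a']] := cr.
(* With these named [p], [r], [q], [s], the rows are [v a a'], [b p r], [b' q s] and the columns
   [v b b'], [a p q], [a' r s]. *)
move: (fourth v a b) (fourth v a' b) (fourth v a b') (fourth v a' b')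
  ap bp pv nvp na'p a'r br rv nvr nar aq b'q qv nvq na'q a's b's sv nvs nas pq rs pr qs.
move=> p r q s ap bp pv nvp na'p a'r br rv nvr nar aq b'q qv nvq na'q a's b's sv nvs nas pq rs pr qs.
have neq c x y : e c x -> ~~ e c y -> x != y by move=> cx; apply: contraNneq => <-.
have disj3 x1 x2 x3 y1 y2 y3 :
    [/\ x1 != y1, x1 != y2 & x1 != y3] -> [/\ x2 != y1, x2 != y2 & x2 != y3] ->
    [/\ x3 != y1, x3 != y2 & x3 != y3] ->
    [disjoint [set x1; x2; x3] & [set y1; y2; y3]].
  move=> [n11 n12 n13] [n21 n22 n23] [n31 n32 n33]; apply/pred0P=> x /=.
  apply/negP=> /andP[]; rewrite !inE -!orbA => /or3P[]/eqP-> /or3P[]; exact/negP.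
have par3 x1 x2 x3 y1 y2 y3 : e x1 y1 -> e x2 y2 -> e x3 y3 ->
    [disjoint [set x1; x2; x3] & [set y1; y2; y3]] ->
    parallel e [set x1; x2; x3] [set y1; y2; y3].
  move=> e1 e2 e3 d; apply/and3P; split=> //; apply/forall_inP=> x;
    rewrite !inE -orbA => /or3P[]/eqP->; apply/exists_inP.
  - by exists y1; rewrite ?inE ?eqxx.
  - by exists y2; rewrite ?inE ?eqxx ?orbT.
  - by exists y3; rewrite ?inE ?eqxx ?orbT.
  - by exists x1; rewrite ?inE ?eqxx.
  - by exists x2; rewrite ?inE ?eqxx ?orbT.
  by exists x3; rewrite ?inE ?eqxx ?orbT.
have l3 := line_set3 eI eC.
split; try by apply: l3.
  split; apply: par3 => //; apply: disj3; split;
    try solve [exact: adj_neq | rewrite eq_sym; exact: adj_neq | by rewrite eq_sym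
      | exact: (neq v) | exact: (neq a) | exact: (neq a') | by rewrite eq_sym (neq v)].
move=> x y z; rewrite !inE -!orbA.
(* Unless [x], [y], [z] form a column, [e x y] or [e x z] is a known non-edge. *)
by case/or3P=> /eqP-> /or3P[]/eqP-> /or3P[]/eqP->;
  rewrite ?(negbTE nvp) ?(negbTE nvq) ?(negbTE nvr) ?(negbTE nvs) ?(negbTE nab)
    ?(negbTE nab') ?(negbTE na'b) ?(negbTE na'b') ?(negbTE nar) ?(negbTE nas)
    ?(negbTE na'p) ?(negbTE na'q).
Qed.

Lemma pattern_grid_extension : grid_extension e.
Proof.
move=> A v b lA vA bA vb.
have [a aA av] := line_other v lA; have va : v != a by rewrite eq_sym.
have [a' [a'A a'v a'a] DA] := line_third lA vA aA va.
have [B lB /andP[vB bB]] := line_through eI eC lam1 vb.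
have [b' [b'B b'v b'b] _] := line_third lB vB bB (adj_neq eI vb).
have b'A : b' \notin A.
  by apply: contra bA => b'A; rewrite (line_eq eC lam1 lA lB vA b'A) // eq_sym.
have adjA := line_adj lA; have adjB := line_adj lB.
have neqA x y : x \in A -> y \notin A -> y != x by move=> xA; apply: contraNneq => ->.
have cr : crossing v a a' b b'.
  split; split; try exact: neqA.
  - exact: adjA.
  - by apply: adjA; rewrite // eq_sym.
  - by apply: adjA; rewrite // eq_sym.
  - exact: vb.
  - by apply: adjB; rewrite // eq_sym.
  by apply: adjB; rewrite // eq_sym.
exists [set b; fourth v a b; fourth v a' b].
exists [set b'; fourth v a b'; fourth v a' b']; split; first by rewrite !inE eqxx.
by rewrite DA; exact: crossing_grid.
Qed.

End PatternGrids.

Theorem theorem3p4p2 (T : finType) (e : rel T)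
    (simple_e : simple_graph e) (connected_e : connected_graph e)
    (srg_e : strongly_regular e 99 14 1 2) :
  ~ follows_paley9_pattern e.
Proof.
move=> /(pattern_grid_extension simple_e srg_e) gridE.
case: simple_e srg_e => eI eC [n99 k14 _ lam1 mu2].
exact: (no_grid_extension eI eC lam1 mu2 n99 k14 gridE).
Qed.
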